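(* Let $(U,Y_U,\mathbf 1,\omega)$ be a vertex operator algebra, let $r=\sum_{t\ge 0} r^t=\sum_{t\ge 0}\sum_{i=1}^{p_t}(\alpha_i^t\otimes\beta_i^t-\beta_i^t\otimes\alpha_i^t)\in \mathrm{SD}(U\widehat{\otimes}U)$ (with $\alpha_i^t,\beta_i^t\in U(t)$) be a diagonal skewsymmetric element, and let $T_r:U'\to U$ be the linear map given by $T_r(f)=\sum_{i=1}^{p_t}\big(\alpha_i^t\langle f,\beta_i^t\rangle-\beta_i^t\langle f,\alpha_i^t\rangle\big)$ for $f\in U(t)^*$, $t\ge 0$. For a given $m\in\mathbb Z$, $r$ is a skewsymmetric solution to the $m$-VOYBE if and only if $T_r:U'\to U$ is a level-preserving $m$-relative Rota-Baxter operator, that is, for all $f,g\in U'$, $$T_r(f)_m T_r(g)=T_r\big(T_r(f)_m g\big)+T_r\big(f(m)T_r(g)\big).$$ In particular, $r$ is a skewsymmetric solution to the VOYBE if and only if $T_r:U'\to U$ is a level-preserving relative Rota-Baxter operator.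
   Context: The base field is $\mathbb C$ and $\mathbb N=\{0,1,2,\dots\}$. A vertex operator algebra (VOA) is understood in the usual sense and is $\mathbb N$-graded, $U=\bigoplus_{n\ge 0}U(n)$ with $\dim U(n)<\infty$, $U(n)$ being the eigenspace of $L(0)$ with eigenvalue $n$; $Y_U(a,z)=\sum_m a_m z^{-m-1}$, $Y_U(\omega,z)=\sum_n L(n)z^{-n-2}$, $\mathrm{wt}(a)=n$ for $a\in U(n)$. Contragredient module: $U'=\bigoplus_{n\ge0}U(n)^*$ with $\langle Y_{U'}(a,z)f,u\rangle=\langle f,Y_U(e^{zL(1)}(-z^{-2})^{L(0)}a,z^{-1})u\rangle$. For $a\in U$, $f\in U'$: $a_m f=\mathrm{Res}_z z^m Y_{U'}(a,z)f$, and $f(m)a=\mathrm{Res}_z z^mY_{U'U}^{U'}(f,z)a$, where $Y_{U'U}^{U'}(f,z)a=e^{zL(-1)}Y_{U'}(a,-z)f$. A linear map $T:U'\to U$ is level-preserving if $T(U(n)^* )\subseteq U(n)$ for all $n$. It is an $m$-relative Rota-Baxter operator (of $U$ associated to the module $U'$) if $T(f)_mT(g)=T(T(f)_mg)+T(f(m)T(g))$ for all $f,g\in U'$, and a relative Rota-Baxter operator if this holds for all $m\in\mathbb Z$. $m$-dot products: for $\alpha,\beta\in U$ and $m\in\mathbb Z$, $\alpha\cdot_m\beta=\beta_m\alpha$; $\alpha\cdot'_m\beta=\mathrm{Res}_z z^m Y_U(e^{zL(1)}(-z^{-2})^{L(0)}\alpha,z^{-1})\beta$; $\alpha\cdot'^{\mathrm{op}}_m\beta=\mathrm{Res}_z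 z^m Y_U(e^{-zL(1)}(-z^{-2})^{L(0)}\beta,-z^{-1})e^{zL(1)}\alpha$. Complete tensor products: $U\widehat{\otimes}U=\prod_{p,q\ge0}U(p)\otimes U(q)$ and $U^{\widehat\otimes 3}=\prod_{p,q,s\ge 0}U(p)\otimes U(q)\otimes U(s)$. The diagonal elements are those of $D(U\widehat\otimes U)=\prod_{t\ge0}U(t)\otimes U(t)$; $\sigma$ is the flip $\sigma(x\otimes y)=y\otimes x$; $\mathrm{SD}(U\widehat\otimes U)$ is the space of diagonal $r$ with $\sigma(r)=-r$. Every such $r$ can be written as $\sum_t\sum_{i=1}^{p_t}(\alpha_i^t\otimes\beta_i^t-\beta_i^t\otimes\alpha_i^t)$. For $r=\sum_t r^t$ with $r^t=\sum_i x_i^t\otimes y_i^t\in U(t)\otimes U(t)$ (finite sum for each $t$), put $r_{12}\cdot_m r_{13}=\sum_{t,s}\sum_{i,k}(x_i^t\cdot_m x_k^s)\otimes y_i^t\otimes y_k^s$, $r_{23}\cdot'_m r_{12}=\sum_{q,t}\sum_{l,i}x_i^t\otimes(x_l^q\cdot'_m y_i^t)\otimes y_l^q$, $r_{13}\cdot'^{\mathrm{op}}_m r_{23}=\sum_{s,q}\sum_{k,l}x_k^s\otimes x_l^q\otimes(y_k^s\cdot'^{\mathrm{op}}_m y_l^q)$, which are well-defined elements of $U^{\widehat\otimes3}$. An $r\in\mathrm{SD}(U\widehat\otimes U)$ is a skewsymmetric solution to the $m$-vertex operator Yang-Baxter equation ($m$-VOYBE) if $r_{12}\cdot_m r_{13}-r_{23}\cdot'_m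 r_{12}+r_{13}\cdot'^{\mathrm{op}}_m r_{23}=0$, and a skewsymmetric solution to the VOYBE if this holds for every $m\in\mathbb Z$. *)

(* Defs.v *)
From HB Require Import structures.
From mathcomp Require Import all_boot all_order all_algebra.
From mathcomp Require Import boolp classical_sets functions cardinality fsbigop.
From mathcomp Require Import zify ring complex.

Set Implicit Arguments.
Unset Strict Implicit.
Unset Printing Implicit Defensive.
Import Order.TTheory GRing.Theory Num.Theory.
Local Open Scope classical_set_scope.
Local Open Scope ring_scope.

Section FiniteSums.
Variables (K : numFieldType) (M : lmodType K) (I : choiceType).
Implicit Types F G : I -> M.

Definition fsupp F := exists s : seq I, forall i, i \notin s -> F i = 0.

Lemma fsum_seq (s : seq I) F : uniq s -> (forall i, i \notin s -> F i = 0) ->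
  \sum_(i \in [set: I]) F i = \sum_(i <- s) F i.
Proof.
move=> us F0; rewrite [RHS]fsbig_seq//; symmetry.
apply: (fsbig_widen [set` s] setT) => // i [_ /=].
by move=> /negP; exact: F0.
Qed.

Lemma fsum_linear c F G : fsupp F -> fsupp G ->
  \sum_(i \in [set: I]) (c *: F i + G i) =
  c *: (\sum_(i \in [set: I]) F i) + \sum_(i \in [set: I]) G i.
Proof.
move=> [s F0] [s' G0]; set r := undup (s ++ s').
have nr i : i \notin r -> F i = 0 /\ G i = 0.
  by rewrite mem_undup mem_cat negb_or => /andP[/F0 -> /G0 ->].
rewrite !(fsum_seq (undup_uniq (s ++ s'))) -/r.
- by rewrite big_split/= scaler_sumr.
all: by move=> i /nr[Fi Gi]; rewrite ?Fi ?Gi ?scaler0 ?addr0.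
Qed.

Lemma fsum_only F j : (forall i, i != j -> F i = 0) ->
  \sum_(i \in [set: I]) F i = F j.
Proof.
move=> F0; rewrite (@fsum_seq [:: j])// ?big_seq1// => i.
by rewrite inE => /F0.
Qed.

Lemma fsupp_linear c F G : fsupp F -> fsupp G -> fsupp (fun i => c *: F i + G i).
Proof.
move=> [s F0] [s' G0]; exists (s ++ s') => i.
by rewrite mem_cat negb_or => /andP[/F0 -> /G0 ->]; rewrite scaler0 addr0.
Qed.

End FiniteSums.

Lemma fsum_map (K : numFieldType) (M N : lmodType K) (I : choiceType)
    (h : {linear M -> N}) (F : I -> M) : fsupp F ->
  h (\sum_(i \in [set: I]) F i) = \sum_(i \in [set: I]) h (F i).
Proof.
move=> [s F0]; have ni i : i \notin undup s -> F i = 0.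
  by rewrite mem_undup; exact: F0.
rewrite !(fsum_seq (undup_uniq s)) ?linear_sum//.
by move=> i /ni ->; rewrite linear0.
Qed.

Section DirectSum.
Variables (K : numFieldType) (V : nat -> vectType K).

(* The direct sum of the V n, [dsingle] being the inclusion of V n. *)
Record dsum := DSum {
  dcoef :> forall n, V n;
  dcoef_fin : exists N, forall n, (N <= n)%N -> dcoef n = 0 }.

Lemma dsumP (u v : dsum) : (forall n, u n = v n) -> u = v.
Proof.
case: u v => [u uP] [v vP] /= uv.
have {}uv : u = v by apply: functional_extensionality_dep.
by case: _ / uv in vP *; rewrite (Prop_irrelevance uP vP).
Qed.

HB.instance Definition _ := gen_eqMixin dsum.
HB.instance Definition _ := gen_choiceMixin dsum.

Lemma dzero_fin : exists N, forall n, (N <= n)%N -> (0 : V n) = 0.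
Proof. by exists 0. Qed.
Definition dzero := DSum dzero_fin.

Lemma dadd_fin (u v : dsum) :
  exists N, forall n, (N <= n)%N -> u n + v n = 0.
Proof.
have [[N uN] [N' vN]] := (dcoef_fin u, dcoef_fin v).
exists (maxn N N') => n; rewrite geq_max => /andP[Nn N'n].
by rewrite uN// vN// addr0.
Qed.
Definition dadd u v := DSum (dadd_fin u v).

Lemma dopp_fin (u : dsum) : exists N, forall n, (N <= n)%N -> - u n = 0.
Proof.
have [N uN] := dcoef_fin u.
by exists N => n Nn; rewrite uN// oppr0.
Qed.
Definition dopp u := DSum (dopp_fin u).

Lemma dscale_fin (c : K) (u : dsum) :
  exists N, forall n, (N <= n)%N -> c *: u n = 0.
Proof.
have [N uN] := dcoef_fin u.
by exists N => n Nn; rewrite uN// scaler0.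
Qed.
Definition dscale c u := DSum (dscale_fin c u).

Lemma daddA : associative dadd.
Proof. by move=> *; apply: dsumP => n /=; rewrite addrA. Qed.
Lemma daddC : commutative dadd.
Proof. by move=> *; apply: dsumP => n /=; rewrite addrC. Qed.
Lemma dadd0 : left_id dzero dadd.
Proof. by move=> *; apply: dsumP => n /=; rewrite add0r. Qed.
Lemma daddN : left_inverse dzero dopp dadd.
Proof. by move=> *; apply: dsumP => n /=; rewrite addNr. Qed.
HB.instance Definition _ := GRing.isZmodule.Build dsum daddA daddC dadd0 daddN.

Lemma dscaleA a b v : dscale a (dscale b v) = dscale (a * b) v.
Proof. by apply: dsumP => n /=; rewrite scalerA. Qed.
Lemma dscale1 : left_id 1 dscale.
Proof. by move=> *; apply: dsumP => n /=; rewrite scale1r. Qed.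
Lemma dscaleDr : right_distributive dscale +%R.
Proof. by move=> *; apply: dsumP => n /=; rewrite scalerDr. Qed.
Lemma dscaleDl v : {morph dscale^~ v : a b / a + b}.
Proof. by move=> *; apply: dsumP => n /=; rewrite scalerDl. Qed.
HB.instance Definition _ :=
  GRing.Zmodule_isLmodule.Build K dsum dscaleA dscale1 dscaleDr dscaleDl.

Definition dproj n (u : dsum) : V n := u n.
Lemma dproj_linear n : linear (dproj n).
Proof. by []. Qed.
HB.instance Definition _ n :=
  GRing.isLinear.Build K dsum (V n) _ (dproj n) (dproj_linear n).

Definition dsingle_fun n (v : V n) : forall k, V k := dfwith (fun k => 0 : V k) v.
Lemma dsingle_fin n (v : V n) :
  exists N, forall k, (N <= k)%N -> dsingle_fun v k = 0.
Proof.
by exists n.+1 => k nk; rewrite /dsingle_fun dfwith_out// neq_ltn nk.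
Qed.
Definition dsingle n (v : V n) := DSum (dsingle_fin v).

Lemma dsingle_in n (v : V n) : dsingle v n = v.
Proof. exact: dfwith_in. Qed.

Lemma dsingle_out n (v : V n) k : n != k -> dsingle v k = 0.
Proof. exact: dfwith_out. Qed.

Lemma dsingle_linear n : linear (@dsingle n).
Proof.
move=> c u v; apply: dsumP => k.
have [<-|nk] := eqVneq n k.
  by rewrite -[RHS]/(c *: dsingle u n + dsingle v n) !dsingle_in.
rewrite -[RHS]/(c *: dsingle u k + dsingle v k).
by rewrite !dsingle_out// scaler0 addr0.
Qed.
HB.instance Definition _ n :=
  GRing.isLinear.Build K (V n) dsum _ (@dsingle n) (@dsingle_linear n).

Lemma dcoefZD c u v n : (c *: u + v : dsum) n = c *: u n + v n.
Proof. by []. Qed.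

Lemma dsum_decomp (u : dsum) N : (forall n, (N <= n)%N -> u n = 0) ->
  u = \sum_(i < N) dsingle (u i).
Proof.
move=> uN; apply: dsumP => n.
rewrite -[RHS]/(dproj n _) linear_sum /=.
have [Nn|nN] := leqP N n.
  rewrite uN// big1// => i _; rewrite -[LHS]/(dsingle (u i) n) dsingle_out//.
  by rewrite neq_ltn (leq_trans (ltn_ord i) Nn).
rewrite (bigD1 (Ordinal nN))//= big1 ?addr0.
  by rewrite -[RHS]/(dsingle (u n) n) dsingle_in.
move=> i; rewrite -val_eqE/= => ni.
by rewrite -[LHS]/(dsingle (u i) n) dsingle_out.
Qed.

Lemma dsum_ind (P : dsum -> Prop) :
  (forall c u v, P u -> P v -> P (c *: u + v)) ->
  (forall n (v : V n), P (dsingle v)) -> forall u, P u.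
Proof.
move=> PD Ps u; have [N uN] := dcoef_fin u; rewrite (dsum_decomp uN).
have P0 : P 0 by rewrite -(linear0 (@dsingle 0)); exact: Ps.
elim/big_ind: _ => // x y Px Py.
by rewrite -[x]scale1r; exact: PD.
Qed.

Definition homogeneous n (u : dsum) := forall k, k != n -> u k = 0.

Lemma homogeneousP n u : homogeneous n u <-> u = dsingle (u n).
Proof.
split=> [hu|-> k kn]; last by rewrite dsingle_out// eq_sym.
apply: dsumP => k; have [->|kn] := eqVneq k n; first by rewrite dsingle_in.
by rewrite hu// dsingle_out// eq_sym.
Qed.

End DirectSum.

Section Tensor.
Variable K : numFieldType.
Implicit Types V W : vectType K.

(* V (x) W, as the matrices of coordinates on the products of basis vectors;
   [tens x y] is x (x) y. The universal property is [tlift_tens] and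
   [tlift_unique]. *)
Definition tensor V W : vectType K := 'M[K]_(\dim {:V}, \dim {:W}).

Definition tens V W (x : V) (y : W) : tensor V W :=
  \matrix_(i, j) (coord (vbasis {:V}) i x * coord (vbasis {:W}) j y).

Definition ebase V (i : 'I_(\dim {:V})) : V := (vbasis {:V})`_i.

Definition tlift V W (Z : lmodType K) (B : V -> W -> Z) (M : tensor V W) : Z :=
  \sum_(i < \dim {:V}) \sum_(j < \dim {:W}) M i j *: B (ebase i) (ebase j).

Definition bilin (V W Z : lmodType K) (B : V -> W -> Z) :=
  (forall y, linear (B ^~ y)) /\ (forall x, linear (B x)).

Lemma ebase_sum V (x : V) :
  x = \sum_(i < \dim {:V}) coord (vbasis {:V}) i x *: ebase i.
Proof. by rewrite [LHS](coord_vbasis (memvf x)). Qed.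

Lemma tens_bilin V W : bilin (@tens V W).
Proof.
split=> z c x y; apply/matrixP => i j; rewrite !mxE linearP/=.
  by rewrite mulrDl mulrA.
by rewrite mulrDr !mulrA (mulrC c).
Qed.

Lemma lin_sum (M N : lmodType K) (h : M -> N) : linear h ->
  forall n (c : 'I_n -> K) (x : 'I_n -> M),
  h (\sum_(i < n) c i *: x i) = \sum_(i < n) c i *: h (x i).
Proof.
move=> hl n c x; pose H := GRing.isLinear.Build K M N _ h hl.
pose h' : {linear M -> N} := HB.pack h H.
by rewrite -[h]/(h' : M -> N) linear_sum; apply: eq_bigr => i _; rewrite linearZ.
Qed.

Lemma tlift_tens V W (Z : lmodType K) (B : V -> W -> Z) x y :
  bilin B -> tlift B (tens x y) = B x y.
Proof.
case=> Bl Br; rewrite {2}[x]ebase_sum (lin_sum (Bl y)); apply: eq_bigr => i _.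
rewrite [in RHS](ebase_sum y) (lin_sum (Br _)) scaler_sumr; apply: eq_bigr => j _.
by rewrite scalerA !mxE.
Qed.

Lemma tlift_linear V W (Z : lmodType K) (B : V -> W -> Z) : linear (tlift B).
Proof.
move=> c M N; rewrite /tlift scaler_sumr -big_split; apply: eq_bigr => i _.
rewrite scaler_sumr -big_split; apply: eq_bigr => j _ /=.
by rewrite !mxE scalerDl scalerA.
Qed.
HB.instance Definition _ V W (Z : lmodType K) (B : V -> W -> Z) :=
  GRing.isLinear.Build K (tensor V W) Z _ (tlift B) (tlift_linear B).

Lemma tensor_span V W (M : tensor V W) : M = tlift (@tens V W) M.
Proof.
rewrite {1}[M]matrix_sum_delta; apply: eq_bigr => i _; apply: eq_bigr => j _.
congr (_ *: _); apply/matrixP => k l; rewrite !mxE.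
by rewrite !coord_free ?(basis_free (vbasisP _))// -natrM mulnb !(eq_sym i) !(eq_sym j).
Qed.

Lemma tlift_unique V W (Z : lmodType K) (B : V -> W -> Z)
    (h : {linear tensor V W -> Z}) :
  (forall x y, h (tens x y) = B x y) -> h =1 tlift B.
Proof.
move=> hB M; rewrite {1}[M]tensor_span /tlift linear_sum.
apply: eq_bigr => i _; rewrite linear_sum; apply: eq_bigr => j _.
by rewrite linearZ hB.
Qed.

Lemma tlift_sum V W (Z : lmodType K) (B : V -> W -> Z) n (x : 'I_n -> V)
    (y : 'I_n -> W) :
  bilin B -> tlift B (\sum_i tens (x i) (y i)) = \sum_i B (x i) (y i).
Proof.
by move=> Bb; rewrite linear_sum; apply: eq_bigr => i _; exact: tlift_tens.
Qed.

Lemma tlift2_sum V W V' W' (Z : lmodType K) (B : V -> W -> V' -> W' -> Z)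
    n (x : 'I_n -> V) (y : 'I_n -> W) n' (x' : 'I_n' -> V') (y' : 'I_n' -> W') :
  (forall a b, bilin (B a b)) ->
  (forall a' b', bilin (fun a b => B a b a' b')) ->
  tlift (fun a b => tlift (B a b) (\sum_k tens (x' k) (y' k)))
        (\sum_i tens (x i) (y i))
  = \sum_i \sum_k B (x i) (y i) (x' k) (y' k).
Proof.
move=> Bb Bb'; rewrite tlift_sum; last first.
  split=> z c u v; rewrite !tlift_sum// scaler_sumr -big_split;
  apply: eq_bigr => k _; first by rewrite (proj1 (Bb' _ _)).
  by rewrite (proj2 (Bb' _ _)).
by apply: eq_bigr => i _; exact: tlift_sum.
Qed.

Lemma tensZDl V W c (x x' : V) (y : W) :
  tens (c *: x + x') y = c *: tens x y + tens x' y.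
Proof. exact: (proj1 (tens_bilin V W)). Qed.

Lemma tensZDr V W c (x : V) (y y' : W) :
  tens x (c *: y + y') = c *: tens x y + tens x y'.
Proof. exact: (proj2 (tens_bilin V W)). Qed.

Definition tflip V W : tensor V W -> tensor W V := tlift (fun x y => tens y x).

Lemma tflipE V W (x : V) (y : W) : tflip (tens x y) = tens y x.
Proof.
by apply: tlift_tens; split=> z c u v; [exact: tensZDr|exact: tensZDl].
Qed.

End Tensor.

Notation "x \ox y" := (tens x y) (at level 40, left associativity) : ring_scope.

(* A formal series in z, z^-1 is the function sending n to its coefficient of
   z^n. *)
Section FormalSeries.
Variables (K : numFieldType) (M N : lmodType K).

Definition fseries (M : lmodType K) := int -> M.

Definition Res (F : fseries M) : M := F (-1).
Definition mulz (m : int) (F : fseries M) : fseries M := fun n => F (n - m).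
(* F(-z) and F(z^-1) *)
Definition negz (F : fseries M) : fseries M := fun n => (-1) ^ n *: F n.
Definition invz (F : fseries M) : fseries M := fun n => F (- n).

(* G(z)p(z) = sum_i z^i G(z)p_i. The sum over [set: int] is that of fsbigop,
   whose value is only meaningful when finitely many terms are nonzero. *)
Definition sapp (G : M -> fseries N) (p : fseries M) : fseries N :=
  fun n => \sum_(i \in [set: int]) G (p i) (n - i).

(* e^{zA} *)
Definition expz (A : M -> M) (u : M) : fseries M :=
  fun n => if n is Posz k then k`!%:R^-1 *: iter k A u else 0.

End FormalSeries.

(* The generalized binomial coefficient (m choose i), m in Z. *)
Definition binz (K : numFieldType) (m : int) (i : nat) : K :=
  (\prod_(j < i) (m%:~R - j%:R)) / i`!%:R.

Section VOA.
Variable K : numFieldType.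

(* L(n) = w_{n+1} *)
Definition Lmode (V : nat -> vectType K)
    (mode : dsum V -> int -> dsum V -> dsum V) (w : V 2) (n : int) :=
  mode (dsingle w) (n + 1).

(* The carrier is the direct sum of the finite-dimensional spaces [grade n], and
   [mode a m b] is a_m b. [borcherds] is the Jacobi identity
     z0^-1 delta((z1-z2)/z0) Y(a,z1)Y(b,z2)c
       - z0^-1 delta((z2-z1)/(-z0)) Y(b,z2)Y(a,z1)c
     = z2^-1 delta((z1-z0)/z2) Y(Y(a,z0)b,z2)c
   at the coefficient of z0^(-l-1) z1^(-m-1) z2^(-n-1); its sums are finite by
   [truncation]. [translation] is Y(L(-1)a,z) = d/dz Y(a,z). *)
Record voa := VOA {
  grade : nat -> vectType K;
  mode : dsum grade -> int -> dsum grade -> dsum grade;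
  vacuum : grade 0;
  conformal : grade 2;
  charge : K;
  mode_linearl : forall m b, linear (fun a => mode a m b);
  mode_linearr : forall a m, linear (mode a m);
  truncation : forall a b, exists N : int, forall m : int, N <= m -> mode a m b = 0;
  vacuum_id : forall m b,
    mode (dsingle vacuum) m b = if m == -1 then b else 0;
  creation : forall a (m : int), 0 <= m -> mode a m (dsingle vacuum) = 0;
  creation1 : forall a, mode a (-1) (dsingle vacuum) = a;
  borcherds : forall (a b c : dsum grade) (l m n : int),
    \sum_(i \in [set: nat])
      binz K m i *: mode (mode a (l + i%:Z) b) (m + n - i%:Z) c
    = \sum_(i \in [set: nat]) ((-1) ^+ i * binz K l i) *:
        (mode a (m + l - i%:Z) (mode b (n + i%:Z) c)
         - (-1) ^ l *: mode b (n + l - i%:Z) (mode a (m + i%:Z) c));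
  virasoro : forall (m n : int) u,
    let L := Lmode mode conformal in
    L m (L n u) - L n (L m u) =
      (m - n)%:~R *: L (m + n) u
      + (if m + n == 0 then (m ^+ 3 - m)%:~R / 12%:R * charge else 0) *: u;
  translation : forall a b (m : int),
    mode (Lmode mode conformal (-1) a) m b = (- m)%:~R *: mode a (m - 1) b;
  weight : forall n u,
    Lmode mode conformal 0 u = n%:R *: u <-> homogeneous n u
}.

Coercion voa_carrier (U : voa) : lmodType K := dsum (grade U).

Variable U : voa.

Definition omega : U := dsingle (conformal U).
Definition L (n : int) : U -> U := @mode U omega (n + 1).

(* Y(a, z)b *)
Definition Y (a b : U) : fseries U := fun n => mode a (- n - 1) b.

(* (-z^{-2})^{L(0)} a *)
Definition zL0 (a : U) : fseries U := fun i =>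
  \sum_(n \in [set: nat])
    if i == - (2 * n%:Z) then (-1) ^+ n *: dsingle (a n) else 0.

(* e^{zL(1)} (-z^{-2})^{L(0)} a *)
Definition adjz (a : U) : fseries U := sapp (expz (L 1)) (zL0 a).

(* e^{-zL(1)} (-z^{-2})^{L(0)} a *)
Definition adjNz (a : U) : fseries U := sapp (expz (fun u => - L 1 u)) (zL0 a).

Definition dot (m : int) (a b : U) : U := mode b m a.

Definition dot' (m : int) (a b : U) : U :=
  Res (mulz m (sapp (fun c => invz (Y c b)) (adjz a))).

Definition dotop (m : int) (a b : U) : U :=
  Res (mulz m
    (sapp (fun c => sapp (fun d => negz (invz (Y c d))) (expz (L 1) a))
          (adjNz b))).

End VOA.

Section SeriesLemmas.
Variable K : numFieldType.

Definition slin (M N : lmodType K) (G : M -> fseries N) :=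
  forall n, linear (fun x => G x n).

Lemma slin0 (M N : lmodType K) (G : M -> fseries N) n : slin G -> G 0 n = 0.
Proof.
by move=> /(_ n (-1) 0 0); rewrite scaler0 addr0 scaleN1r addNr.
Qed.

Lemma fsupp_shift (M : lmodType K) (F : fseries M) i :
  fsupp F -> fsupp (fun n => F (n - i)).
Proof.
move=> [s F0]; exists [seq j + i | j <- s] => n.
move=> ns; apply: F0; apply: contra ns => ns.
by apply/mapP; exists (n - i) => //; rewrite subrK.
Qed.

Lemma sapp_fsupp (M N : lmodType K) (G : M -> fseries N) p :
  slin G -> fsupp p -> (forall x, fsupp (G x)) -> fsupp (sapp G p).
Proof.
move=> Gl [s p0] Gs.
have E n : sapp G p n = \sum_(i <- undup s) G (p i) (n - i).
  apply: fsum_seq (undup_uniq s) _ => i.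
  by rewrite mem_undup => /p0 ->; exact: slin0.
suff [t t0] : fsupp (fun n => \sum_(i <- undup s) G (p i) (n - i)).
  by exists t => n /t0; rewrite E.
elim: (undup s) => [|i r [t IHr]]; first by exists [::] => n; rewrite big_nil.
have [t' t'0] := fsupp_shift i (Gs (p i)).
exists (t ++ t') => n; rewrite mem_cat negb_or big_cons => /andP[/IHr -> /t'0 ->].
by rewrite addr0.
Qed.

Lemma sapp_term_fsupp (M N : lmodType K) (G : M -> fseries N) p n :
  slin G -> fsupp p -> fsupp (fun i => G (p i) (n - i)).
Proof. by move=> Gl [s p0]; exists s => i /p0 ->; exact: slin0. Qed.

Lemma sapp_slin (X M N : lmodType K) (G : M -> fseries N) (p : X -> fseries M) :
  slin G -> slin p -> (forall x, fsupp (p x)) -> slin (fun x => sapp G (p x)).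
Proof.
move=> Gl pl ps n c x y; rewrite /sapp -fsum_linear.
- by apply: eq_fsbigr => i _; rewrite pl Gl.
- exact: sapp_term_fsupp.
- exact: sapp_term_fsupp.
Qed.

Lemma sapp_slinl (X M N : lmodType K) (G : X -> M -> fseries N) p :
  (forall x, slin (G x)) -> (forall u, slin (G ^~ u)) -> fsupp p ->
  slin (fun x => sapp (G x) p).
Proof.
move=> Gl Gl' ps n c x y; rewrite /sapp -fsum_linear.
- by apply: eq_fsbigr => i _; rewrite (Gl' (p i)).
- exact: sapp_term_fsupp.
- exact: sapp_term_fsupp.
Qed.

Lemma expz_slin (M : lmodType K) (A : M -> M) : linear A -> slin (expz A).
Proof.
move=> Al [k|k] c x y /=; last by rewrite scaler0 addr0.
suff -> : iter k A (c *: x + y) = c *: iter k A x + iter k A y.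
  by rewrite scalerDr !scalerA mulrC.
by elim: k => // k IHk; rewrite !iterS IHk Al.
Qed.

Lemma expz_fsupp (M : lmodType K) (A : M -> M) u :
  (exists N, forall k, (N <= k)%N -> iter k A u = 0) -> fsupp (expz A u).
Proof.
move=> [N AN]; exists [seq k%:Z | k <- iota 0 N] => -[k|k]//= nk.
rewrite AN ?scaler0// leqNgt; apply: contra nk => kN.
by apply/mapP; exists k; rewrite ?mem_iota.
Qed.

End SeriesLemmas.

Section Grading.
Variables (K : numFieldType) (U : voa K).
Implicit Types a b c : U.

HB.instance Definition _ a m := GRing.isLinear.Build K U U _ (@mode K U a m)
  (mode_linearr a m).

Definition moder m b (a : U) : U := mode a m b.
Lemma moder_linear m b : linear (moder m b).
Proof. exact: mode_linearl. Qed.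
HB.instance Definition _ m b := GRing.isLinear.Build K U U _ (moder m b)
  (moder_linear m b).

HB.instance Definition _ n := GRing.isLinear.Build K U U _ (@L K U n)
  (mode_linearr (omega U) (n + 1)).

Lemma mode0l m b : mode (0 : U) m b = 0.
Proof. exact: (linear0 (moder m b)). Qed.

Lemma L0_mode a n c : L 0 (mode a n c) =
  mode (L (-1) a) (n + 1) c + mode (L 0 a) n c + mode a n (L 0 c).
Proof.
have := borcherds (omega U) a c 0 1 n.
rewrite (@fsum_seq _ _ _ (iota 0 2)) ?iota_uniq//; last first.
  move=> [|[|i]]// _; rewrite /binz; have i2 : (1 < i.+2)%N by [].
  by rewrite (bigD1 (Ordinal i2))//= subrr !mul0r scale0r.
rewrite [X in _ = X -> _](@fsum_seq _ _ _ (iota 0 1)) ?iota_uniq//; last first.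
  move=> [|i]// _; rewrite /binz (bigD1 ord0)//= subrr !(mul0r, mulr0).
  by rewrite scale0r.
rewrite !big_cons !big_nil /binz !big_ord0 big_ord1 /= !addr0 subr0.
rewrite !fact0 !divr1 expr0 mulr1 !scale1r ?expr0z ?expr0 ?scale1r ?subr0 ?add0r.
move=> /esym/eqP; rewrite subr_eq => /eqP.
by rewrite /L !add0r (_ : 1 + n - 1 = n) ?(addrC 1 n) ?addrK// addNr.
Qed.

Lemma L0_single n (v : grade U n) : L 0 (dsingle v : U) = n%:R *: dsingle v.
Proof. by apply/weight/homogeneousP; rewrite dsingle_in. Qed.

Lemma L0_coef a k : (L 0 a) k = k%:R *: a k.
Proof.
elim/dsum_ind: a => [c u v uk vk|n v].
  by rewrite linearP !dcoefZD uk vk scalerDr !scalerA mulrC.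
rewrite L0_single -[LHS]/(n%:R *: dsingle v k).
have [e|nk] := eqVneq n k; first by case: _ / e.
by rewrite dsingle_out// !scaler0.
Qed.

Lemma mode_homog p (v : grade U p) m q (w : grade U q) (k : nat) :
  k%:Z != p%:Z + q%:Z - m - 1 -> (mode (dsingle v) m (dsingle w)) k = 0.
Proof.
move=> kn; have := congr1 (@dproj _ _ k) (L0_mode (dsingle v) m (dsingle w)).
rewrite -[LHS]/((L 0 _) k) L0_coef translation L0_single.
rewrite -[mode (p%:R *: _) _ _]/(moder _ _ _) linearZ /= L0_single linearZ /=.
rewrite addrK /moder -!scalerDl -[RHS]/(_ *: (mode (dsingle v) m (dsingle w)) k).
move=> /eqP; rewrite -subr_eq0 -scalerBl scaler_eq0 => /orP[|/eqP//].
rewrite subr_eq0 => /eqP e; case/negP: kn; apply/eqP/(@intr_inj K).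
rewrite -[LHS]/(k%:R) e !(rmorphD, rmorphN) /= -!pmulrn; ring.
Qed.

Definition ihomog (w : int) a := forall k : nat, k%:Z != w -> a k = 0.

Lemma ihomogP w a : ihomog w a ->
  a = 0 \/ exists2 n : nat, w = n & a = dsingle (a n).
Proof.
case: w => [n|n] ha; [right; exists n|left] => //.
  by apply/homogeneousP => k kn; apply: ha; rewrite eqz_nat.
by apply: dsumP => k; apply: ha.
Qed.

Lemma ihomog0 w : ihomog w 0. Proof. by []. Qed.

Lemma ihomog_single n (v : grade U n) : ihomog n (dsingle v).
Proof. by move=> k kn; rewrite dsingle_out// eq_sym. Qed.

Lemma ihomogZ w (x : K) a : ihomog w a -> ihomog w (x *: a).
Proof. by move=> ha k /ha ak; rewrite -[LHS]/(x *: a k) ak scaler0. Qed.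

Lemma ihomog_mode w w' m a b : ihomog w a -> ihomog w' b ->
  ihomog (w + w' - m - 1) (mode a m b).
Proof.
move=> /ihomogP[->|[p -> ->]]; first by rewrite mode0l.
move=> /ihomogP[->|[q -> ->]]; first by rewrite linear0.
by move=> k; exact: mode_homog.
Qed.

Lemma ihomog_L n w a : ihomog w a -> ihomog (w - n) (L n a).
Proof.
move=> ha; have := ihomog_mode (m := n + 1) (ihomog_single (conformal U)) ha.
by rewrite (_ : _ - 1 = w - n)//; ring.
Qed.

Lemma ihomog_iterL1 k w a : ihomog w a -> ihomog (w - k%:Z) (iter k (L 1) a).
Proof.
elim: k => [|k IHk] ha; first by rewrite subr0.
rewrite iterS (_ : w - k.+1%:Z = w - k%:Z - 1); last by rewrite intS; ring.
exact/ihomog_L/IHk.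
Qed.

Lemma L1_nilp a : exists N, forall k, (N <= k)%N -> iter k (L 1) a = 0.
Proof.
elim/dsum_ind: a => [c u v [N uN] [N' vN]|n v].
  exists (maxn N N') => k; rewrite geq_max => /andP[/uN uk /vN vk].
  suff -> : iter k (L 1) (c *: u + v) = c *: iter k (L 1) u + iter k (L 1) v.
    by rewrite uk vk scaler0 addr0.
  by elim: k {uk vk} => // k IHk; rewrite !iterS IHk linearP.
exists n.+1 => k nk; apply: dsumP => j.
apply: (ihomog_iterL1 (k := k) (ihomog_single v)).
by apply: contraTneq nk => /eqP; rewrite -leqNgt; lia.
Qed.

Lemma L1_linear : linear (@L K U 1). Proof. exact: linearP. Qed.

Lemma NL1_linear : linear (fun a => - L 1 a).
Proof. by move=> c x y; rewrite linearP opprD scalerN. Qed.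

Lemma expL1_fsupp a : fsupp (expz (L 1) a).
Proof. by apply: expz_fsupp; exact: L1_nilp. Qed.

Lemma expNL1_fsupp a : fsupp (expz (fun u => - L 1 u) a).
Proof.
apply: expz_fsupp; have [N LN] := L1_nilp a; exists N => k /LN Lk.
suff -> : iter k (fun u => - L 1 u) a = (-1) ^+ k *: iter k (L 1) a.
  by rewrite Lk scaler0.
elim: k {Lk} => [|k IHk]; first by rewrite expr0 scale1r.
by rewrite !iterS IHk linearZ exprS mulN1r scaleNr.
Qed.

Lemma zL0_slin : slin (@zL0 K U).
Proof.
move=> i c x y; rewrite /zL0 -fsum_linear.
- apply: eq_fsbigr => n _; case: ifP => _; last by rewrite scaler0 addr0.
  by rewrite dcoefZD linearP scalerDr !scalerA mulrC.
- exists (iota 0 `|i|.+1) => n; rewrite mem_iota => ni.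
  by case: eqP => // e; exfalso; lia.
- exists (iota 0 `|i|.+1) => n; rewrite mem_iota => ni.
  by case: eqP => // e; exfalso; lia.
Qed.

Lemma zL0_single n (v : grade U n) i :
  zL0 (dsingle v : U) i =
    if i == - (2 * n%:Z) then (-1) ^+ n *: dsingle v else 0.
Proof.
rewrite /zL0 (fsum_only (j := n)) ?dsingle_in// => k kn.
by rewrite dsingle_out 1?eq_sym// linear0 scaler0 if_same.
Qed.

Lemma zL0_fsupp a : fsupp (zL0 a).
Proof.
elim/dsum_ind: a => [c u v us vs|n v].
  have [s s0] := fsupp_linear c us vs.
  by exists s => i /s0; rewrite zL0_slin.
exists [:: - (2 * n%:Z)] => i; rewrite inE zL0_single.
by case: ifP.
Qed.

Lemma adjz_slin : slin (@adjz K U).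
Proof.
by apply: sapp_slin zL0_slin zL0_fsupp; apply: expz_slin; exact: L1_linear.
Qed.

Lemma adjz_fsupp a : fsupp (adjz a).
Proof.
by apply: sapp_fsupp (zL0_fsupp a) expL1_fsupp; apply: expz_slin;
  exact: L1_linear.
Qed.

Lemma adjNz_slin : slin (@adjNz K U).
Proof.
by apply: sapp_slin zL0_slin zL0_fsupp; apply: expz_slin; exact: NL1_linear.
Qed.

Lemma adjNz_fsupp a : fsupp (adjNz a).
Proof.
by apply: sapp_fsupp (zL0_fsupp a) expNL1_fsupp; apply: expz_slin;
  exact: NL1_linear.
Qed.

Lemma adjz_single n (v : grade U n) i :
  ihomog (- n%:Z - i) (adjz (dsingle v : U) i).
Proof.
rewrite /adjz /sapp (fsum_only (j := - (2 * n%:Z))) => [|j /negPf jn].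
  rewrite zL0_single eqxx; set u := _ *: _.
  have hu : ihomog n u by apply/ihomogZ/ihomog_single.
  case E : (i - - (2 * n%:Z)) => [k|k] //=.
  apply: ihomogZ; rewrite (_ : - n%:Z - i = n%:Z - k%:Z); first exact: ihomog_iterL1.
  by rewrite -[k%:Z]E; ring.
by rewrite zL0_single jn; apply: slin0; apply: expz_slin; exact: L1_linear.
Qed.

Lemma Y_slinl b : slin (fun a => Y a b).
Proof. by move=> n; exact: mode_linearl. Qed.

Lemma Y_slinr a : slin (Y a).
Proof. by move=> n; exact: mode_linearr. Qed.

Lemma dot_bilin m : bilin (@dot K U m).
Proof. by split=> x; [exact: mode_linearr|exact: mode_linearl]. Qed.

Lemma dot'_bilin m : bilin (@dot' K U m).
Proof.
have Gl b : slin (fun c : U => invz (Y c b)) by move=> n; exact: Y_slinl.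
split=> [b|a]; rewrite /dot' /Res /mulz.
  exact: (sapp_slin (Gl b) adjz_slin adjz_fsupp).
apply: (sapp_slinl (G := fun b c => invz (Y c b)) Gl _ (adjz_fsupp a)).
by move=> c n; exact: Y_slinr.
Qed.

Lemma dotop_bilin m : bilin (@dotop K U m).
Proof.
have Hr (c : U) : slin (fun d : U => negz (invz (Y c d))).
  by move=> n k x y; rewrite /negz /invz Y_slinr scalerDr !scalerA mulrC.
have Hl (d : U) : slin (fun c : U => negz (invz (Y c d))).
  by move=> n k x y; rewrite /negz /invz Y_slinl scalerDr !scalerA mulrC.
pose H (a c : U) := sapp (fun d => negz (invz (Y c d))) (expz (L 1) a).
have Gl a : slin (H a).
  exact: (sapp_slinl (G := fun c d => negz (invz (Y c d))) Hr Hl (expL1_fsupp a)).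
have Gr c : slin (H ^~ c).
  apply: (sapp_slin (Hr c) _ expL1_fsupp).
  by apply: expz_slin; exact: L1_linear.
split=> [b|a]; rewrite /dotop /Res /mulz.
  exact: (sapp_slinl Gl Gr (adjNz_fsupp b)).
exact: (sapp_slin (Gl a) adjNz_slin adjNz_fsupp).
Qed.

Lemma dot'_homog p (v : grade U p) m q (w : grade U q) :
  ihomog (q%:Z - p%:Z + m + 1) (dot' m (dsingle v : U) (dsingle w)).
Proof.
rewrite /dot' /Res /mulz /sapp => k kn.
rewrite -[LHS]/(dproj k _) fsum_map/=; last first.
  have Gl : slin (fun c : U => invz (Y c (dsingle w))).
    by move=> n; exact: Y_slinl.
  exact: (sapp_term_fsupp _ Gl (adjz_fsupp (dsingle v))).
apply: fsbig1 => i _; rewrite /invz /Y.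
have := ihomog_mode (m := - - (-1 - m - i) - 1) (@adjz_single p v i) (ihomog_single w).
by apply; apply: contra_neq kn => ->; ring.
Qed.

End Grading.

Section Contragredient.
Variables (K : numFieldType) (U : voa K).

(* U', the direct sum of the duals U(n)^* *)
Definition cdual := dsum (fun n => 'Hom(grade U n, K^o)).
Implicit Types (f : cdual) (a u : U).

(* <f, u> *)
Definition pair f u : K := \sum_(n \in [set: nat]) (f n (u n) : K^o).

Lemma pair_fsupp f u : fsupp (fun n => f n (u n) : K^o).
Proof.
have [N uN] := dcoef_fin u; exists (iota 0 N) => n.
by rewrite mem_iota -leqNgt => /uN ->; rewrite linear0.
Qed.

Lemma pair_linear f : linear (pair f : U -> K^o).
Proof.
move=> c u v; rewrite /pair -fsum_linear; try exact: pair_fsupp.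
by apply: eq_fsbigr => n _; rewrite dcoefZD linearP.
Qed.

Lemma pair_single f n (v : grade U n) : pair f (dsingle v) = f n v.
Proof.
rewrite /pair (fsum_only (j := n)) ?dsingle_in// => k kn.
by rewrite dsingle_out 1?eq_sym// linear0.
Qed.

Definition cform m a f n (v : grade U n) : K^o := pair f (dot' m a (dsingle v)).

Lemma cform_linear m a f n : linear (@cform m a f n).
Proof.
move=> c x y; rewrite /cform linearP; have [_ /(_ a) ->] := @dot'_bilin K U m.
exact: pair_linear.
Qed.
HB.instance Definition _ m a f n :=
  GRing.isLinear.Build K (grade U n) K^o _ (@cform m a f n)
    (cform_linear m a f (n := n)).

Lemma cmode_fin m a f : exists N, forall n, (N <= n)%N ->
  linfun (@cform m a f n) = 0.
Proof.
elim/dsum_ind: a => [c x y [N xN] [N' yN]|p w].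
  exists (maxn N N') => n; rewrite geq_max => /andP[/xN xn /yN yn].
  apply/lfunP => v; rewrite lfunE zero_lfunE /= /cform.
  have [/(_ (dsingle v)) -> _] := @dot'_bilin K U m.
  have := congr1 (fun h : 'Hom(_, _) => h v) xn.
  rewrite /= lfunE zero_lfunE /= /cform => xv.
  have := congr1 (fun h : 'Hom(_, _) => h v) yn.
  rewrite /= lfunE zero_lfunE /= /cform => yv.
  by rewrite pair_linear xv yv scaler0 addr0.
have [N fN] := dcoef_fin f; exists (N + p + `|m|)%N => n Nn.
apply/lfunP => v; rewrite lfunE zero_lfunE /= /cform /pair.
apply: fsbig1 => k _; have [Nk|kN] := leqP N k; first by rewrite fN// zero_lfunE.
rewrite (dot'_homog w v) ?linear0//.
by apply/eqP; lia.
Qed.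

(* a_m f, with <a_m f, u> = <f, Res_z z^m Y(e^{zL(1)}(-z^{-2})^{L(0)}a, z^{-1})u> *)
Definition cmode a (m : int) f : cdual := DSum (cmode_fin m a f).

Lemma pair_cmode a m f u : pair (cmode a m f) u = pair f (dot' m a u).
Proof.
elim/dsum_ind: u => [c x y hx hy|n v].
  have [_ /(_ a) ->] := @dot'_bilin K U m.
  by rewrite !pair_linear hx hy.
by rewrite pair_single lfunE.
Qed.

(* Y_{U'}(a, z)f *)
Definition cY a f : fseries cdual := fun n => cmode a (- n - 1) f.

Definition cL (n : int) f : cdual := cmode (omega U) (n + 1) f.

(* f(m)a, the modes of e^{zL(-1)}Y_{U'}(a, -z)f *)
Definition cdmode f (m : int) a : cdual :=
  Res (mulz m (sapp (expz (cL (-1))) (negz (cY a f)))).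

Lemma cmode_truncation a f :
  exists N : int, forall m : int, N <= m -> cmode a m f = 0.
Proof.
have [N fN] := dcoef_fin f.
suff [M hM] : exists M : int, forall m : int, M <= m -> forall u,
    pair f (dot' m a u) = 0.
  exists M => m /hM f0; apply: dsumP => n; apply/lfunP => v.
  by rewrite -pair_single pair_cmode f0 zero_lfunE.
elim/dsum_ind: a => [c x y [X hX] [Z hZ]|p w].
  exists (Num.max X Z) => m; rewrite ge_max => /andP[/hX xm /hZ ym] u.
  have [/(_ u) -> _] := @dot'_bilin K U m.
  by rewrite pair_linear xm ym scaler0 addr0.
exists (N + p)%:Z => m Nm; elim/dsum_ind => [c x y hx hy|q v].
  have [_ ->] := @dot'_bilin K U m.
  by rewrite pair_linear hx hy scaler0 addr0.
rewrite /pair; apply: fsbig1 => k _.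
have [Nk|kN] := leqP N k; first by rewrite fN// zero_lfunE.
rewrite (dot'_homog w v) ?linear0//.
by apply/eqP; lia.
Qed.

Lemma cdmode_fsupp f a n :
  fsupp (fun i => expz (cL (-1)) (negz (cY a f) i) (n - i)).
Proof.
have [N aN] := cmode_truncation a f.
exists [seq n - k%:Z | k <- iota 0 `|n + N + 2|.+1] => i ni.
case E : (n - i) => [k|k] //=.
have [iN|Ni] := leP i (- N - 1).
  rewrite /negz /cY aN ?scaler0; last by lia.
  suff -> : iter k (cL (-1)) 0 = 0 by rewrite scaler0.
  elim: k {E} => // k IHk; rewrite iterS IHk.
  apply: dsumP => q; apply/lfunP => v.
  rewrite -pair_single pair_cmode zero_lfunE.
  by apply: fsbig1 => j _; rewrite zero_lfunE.
case/negP: ni; apply/mapP; exists k; last by rewrite -E; ring.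
by rewrite mem_iota; lia.
Qed.

Definition relative_RB_at (m : int) (T : {linear cdual -> U}) :=
  forall f g, mode (T f) m (T g) = T (cmode (T f) m g) + T (cdmode f m (T g)).

Definition relative_RB (T : {linear cdual -> U}) :=
  forall m, relative_RB_at m T.

Definition level_preserving (T : {linear cdual -> U}) :=
  forall n f, homogeneous n f -> homogeneous n (T f).

End Contragredient.

Section VOYBE.
Variables (K : numFieldType) (U : voa K).
Local Notation V := (grade U).

Definition ctensor2 := forall p q, tensor (V p) (V q).
Definition ctensor3 := forall p q s, tensor (tensor (V p) (V q)) (V s).

Definition diagonal (r : ctensor2) := forall p q, p != q -> r p q = 0.

Definition cflip (r : ctensor2) : ctensor2 := fun p q => tflip (r q p).

Definition SD (r : ctensor2) :=
  diagonal r /\ forall p q, cflip r p q = - r p q.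

(* The components in U(p) (x) U(q) (x) U(s) of the three products, for
   diagonal r = sum_t r^t with r^t = [r t t]. The factor on which a product of U acts is not homogeneous:
   its component of the right weight is selected, and the weights of the two
   other factors determine which r^t contribute. *)
Definition r12_r13 m (r : ctensor2) : ctensor3 := fun p q s =>
  tlift (fun x y => tlift (fun x' y' =>
    dot m (dsingle x) (dsingle x' : U) p \ox y \ox y') (r s s)) (r q q).

Definition r23_r12 m (r : ctensor2) : ctensor3 := fun p q s =>
  tlift (fun x y => tlift (fun x' y' =>
    x \ox dot' m (dsingle x') (dsingle y : U) q \ox y') (r s s)) (r p p).

Definition r13_r23 m (r : ctensor2) : ctensor3 := fun p q s =>
  tlift (fun x y => tlift (fun x' y' =>
    x \ox x' \ox dotop m (dsingle y) (dsingle y' : U) s) (r q q)) (r p p).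

Definition skew_sol_mVOYBE (m : int) (r : ctensor2) :=
  SD r /\ forall p q s,
    r12_r13 m r p q s - r23_r12 m r p q s + r13_r23 m r p q s = 0.

Definition skew_sol_VOYBE (r : ctensor2) := forall m, skew_sol_mVOYBE m r.

(* Whatever the expression of the r^t as sums of pure tensors, the three
   products are given by the usual formulas. *)
Section Expansion.
Variables (m : int) (r : ctensor2) (N : nat -> nat).
Variables (x y : forall t, 'I_(N t) -> V t).
Hypothesis rE : forall t, r t t = \sum_(i < N t) x i \ox y i.

Lemma r12_r13E p q s : r12_r13 m r p q s =
  \sum_(i < N q) \sum_(k < N s)
    dot m (dsingle (x i)) (dsingle (x k) : U) p \ox y i \ox y k.
Proof.
have [dl dr] := @dot_bilin K U m.
rewrite /r12_r13 !rE; apply: tlift2_sum => a b; split=> z c u v;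
by rewrite ?dsingle_linear ?dl ?dr ?dcoefZD ?tensZDl ?tensZDr ?tensZDl.
Qed.

Lemma r23_r12E p q s : r23_r12 m r p q s =
  \sum_(i < N p) \sum_(l < N s)
    x i \ox dot' m (dsingle (x l)) (dsingle (y i) : U) q \ox y l.
Proof.
have [dl dr] := @dot'_bilin K U m.
rewrite /r23_r12 !rE; apply: tlift2_sum => a b; split=> z c u v;
by rewrite ?dsingle_linear ?dl ?dr ?dcoefZD ?tensZDl ?tensZDr ?tensZDl.
Qed.

Lemma r13_r23E p q s : r13_r23 m r p q s =
  \sum_(k < N p) \sum_(l < N q)
    x k \ox x l \ox dotop m (dsingle (y k)) (dsingle (y l) : U) s.
Proof.
have [dl dr] := @dotop_bilin K U m.
rewrite /r13_r23 !rE; apply: tlift2_sum => a b; split=> z c u v;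
by rewrite ?dsingle_linear ?dl ?dr ?dcoefZD ?tensZDl ?tensZDr ?tensZDl.
Qed.

End Expansion.

End VOYBE.

Section OperatorOfTensor.
Variables (K : numFieldType) (U : voa K) (p : nat -> nat).
Variables alpha beta : forall t, 'I_(p t) -> grade U t.
Implicit Types f : cdual U.

(* T_r for r^t = sum_i (alpha_i^t (x) beta_i^t - beta_i^t (x) alpha_i^t). *)
Definition Tr f : U := \sum_(t \in [set: nat]) dsingle
  (\sum_(i < p t) ((f t (beta i) : K) *: alpha i - (f t (alpha i) : K) *: beta i)).

Lemma Tr_linear : linear Tr.
Proof.
have fs f : fsupp (fun t => dsingle (\sum_(i < p t)
    ((f t (beta i) : K) *: alpha i - (f t (alpha i) : K) *: beta i)) : U).
  have [N fN] := dcoef_fin f; exists (iota 0 N) => t.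
  rewrite mem_iota -leqNgt => /fN ft; rewrite big1 ?linear0// => i _.
  by rewrite ft !zero_lfunE !scale0r subr0.
move=> c f g; rewrite /Tr -(fsum_linear c (fs f) (fs g)).
apply: eq_fsbigr => t _; rewrite -linearP/= scaler_sumr -big_split/=.
congr (dsingle _); apply: eq_bigr => i _.
rewrite !(add_lfunE, scale_lfunE) !scalerDl !scalerBr !scalerA.
by rewrite opprD addrACA.
Qed.
HB.instance Definition _ :=
  GRing.isLinear.Build K (cdual U) U _ Tr Tr_linear.

Lemma Tr_single t (f : 'Hom(grade U t, K^o)) : Tr (dsingle f) = dsingle
  (\sum_(i < p t) ((f (beta i) : K) *: alpha i - (f (alpha i) : K) *: beta i)).
Proof.
rewrite /Tr (fsum_only (j := t)) ?dsingle_in// => k kt.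
rewrite big1 ?linear0// => i _.
by rewrite dsingle_out 1?eq_sym// !zero_lfunE !scale0r subr0.
Qed.

End OperatorOfTensor.

(* Main.v *)
(* The functionals h (x) f (x) g separate the points of U(k) (x) U(q) (x) U(s).
   Contracting r on the right gives T_r and, by skewsymmetry, contracting it on
   the left gives - T_r, so that the three products of the m-VOYBE evaluate to
     <h, T(g)_m T(f)>,  - <f, T(g) .'_m T(h)>,  <g, T(h) .'op_m T(f)>.
   Now .'_m is adjoint to the action on U', and .'op_m to g(m) because L(-1) on
   U' is adjoint to L(1) on U (as L(1)omega = 0). Moving these operations and
   then T_r across the pairing, where T_r is skew, turns the m-VOYBE into the
   Rota-Baxter identity for g and f, paired with h. *)
Require Import Defs.
From HB Require Import structures.
From mathcomp Require Import all_boot all_order all_algebra.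
From mathcomp Require Import classical_sets fsbigop reals zify complex.

Set Implicit Arguments.
Unset Strict Implicit.
Unset Printing Implicit Defensive.
Import Order.TTheory GRing.Theory Num.Theory.

Local Open Scope ring_scope.

(** * Functionals on tensor products *)

Section Tensors.
Variable K : numFieldType.
Implicit Types V W X : vectType K.

Lemma functional_eq0 V (v : V) : (forall f : 'Hom(V, K^o), f v = 0) -> v = 0.
Proof.
move=> v0; rewrite [v]ebase_sum big1 // => i _.
have := v0 (linfun (coord (vbasis {:V}) i : V -> K^o)).
by rewrite lfunE /= => ->; rewrite scale0r.
Qed.

Definition contractr V W (g : 'Hom(W, K^o)) : tensor V W -> V :=
  tlift (fun w z => (g z : K) *: w).

Lemma contractr_bilin V W (g : 'Hom(W, K^o)) :
  bilin (fun (w : V) (z : W) => (g z : K) *: w).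
Proof.
split=> z c u v; first by rewrite scalerDr !scalerA mulrC.
by rewrite linearP scalerDl scalerA.
Qed.

Lemma contractr_tens V W (g : 'Hom(W, K^o)) (x : V) y :
  contractr g (x \ox y) = (g y : K) *: x.
Proof. by rewrite /contractr (tlift_tens _ _ (contractr_bilin _ _)). Qed.

(** For [g] the [j]-th coordinate functional, the coordinates of the contraction are column [j] of
    [M]. *)
Lemma contractr_eq0 V W (M : tensor V W) :
  (forall g, contractr g M = 0) -> M = 0.
Proof.
move=> M0; apply/matrixP => i j; rewrite mxE.
have free (U : vectType K) := basis_free (vbasisP {:U}).
pose g := linfun (coord (vbasis {:W}) j : W -> K^o).
have gE k : g (ebase k) = (k == j)%:R.
  by rewrite lfunE /= /ebase coord_free // eq_sym.
have ME : contractr g M = \sum_k M k j *: (vbasis {:V})`_k.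
  apply: eq_bigr => k _; rewrite (bigD1 j) //= big1 => [|l lj].
    by rewrite gE eqxx scale1r addr0.
  by rewrite gE (negPf lj) scale0r scaler0.
by rewrite -(coord_sum_free (fun k => M k j) i (free V)) -ME M0 linear0.
Qed.

Definition eval3 V W X (h : 'Hom(V, K^o)) (f : 'Hom(W, K^o)) (g : 'Hom(X, K^o))
    (M : tensor (tensor V W) X) : K^o :=
  h (contractr f (contractr g M)).

Lemma eval3_linear V W X (h : 'Hom(V, K^o)) (f : 'Hom(W, K^o))
  (g : 'Hom(X, K^o)) : linear (eval3 h f g).
Proof. by move=> c M N; rewrite /eval3 /contractr !linearP. Qed.
HB.instance Definition _ V W X (h : 'Hom(V, K^o)) (f : 'Hom(W, K^o))
    (g : 'Hom(X, K^o)) :=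
  GRing.isLinear.Build K (tensor (tensor V W) X) K^o _ (eval3 h f g)
    (eval3_linear h f g).

Lemma eval3_tens V W X (h : 'Hom(V, K^o)) (f : 'Hom(W, K^o))
    (g : 'Hom(X, K^o)) x y z :
  eval3 h f g (x \ox y \ox z) = (h x : K) * f y * g z.
Proof.
rewrite /eval3 contractr_tens /contractr linearZ /= -/(contractr f _).
rewrite contractr_tens !linearZ /=.
by rewrite -[LHS]/((g z : K) * ((f y : K) * (h x : K))) mulrC (mulrC (f y : K)).
Qed.

Lemma eval3_eq0 V W X (M : tensor (tensor V W) X) :
  (forall h f g, eval3 h f g M = 0) -> M = 0.
Proof.
move=> M0; apply: contractr_eq0 => g; apply: contractr_eq0 => f.
by apply: functional_eq0 => h; exact: M0.
Qed.

Lemma bilin_lincomb (V1 V2 Z : lmodType K) (B : V1 -> V2 -> Z) n n'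
    (a : 'I_n -> K) (x : 'I_n -> V1) (b : 'I_n' -> K) (y : 'I_n' -> V2) :
  bilin B -> B (\sum_i a i *: x i) (\sum_k b k *: y k) =
  \sum_i \sum_k (a i * b k) *: B (x i) (y k).
Proof.
case=> Bl Br; rewrite (lin_sum (Bl _)); apply: eq_bigr => i _.
rewrite (lin_sum (Br _)) scaler_sumr; apply: eq_bigr => k _.
by rewrite scalerA.
Qed.

Lemma bilin_oppr (V1 V2 Z : lmodType K) (B : V1 -> V2 -> Z) x y :
  bilin B -> B x (- y) = - B x y.
Proof.
case=> _ /(_ x) Br; have B0 : B x 0 = 0.
  by have := Br (-1) 0 0; rewrite scaler0 addr0 scaleN1r addNr.
by have := Br (-1) y 0; rewrite B0 !addr0 !scaleN1r.
Qed.

Lemma bilin_oppl (V1 V2 Z : lmodType K) (B : V1 -> V2 -> Z) x y :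
  bilin B -> B (- x) y = - B x y.
Proof. by case=> Bl Br; apply: (@bilin_oppr _ _ _ (fun v u => B u v)). Qed.

(** Absorbing the sum over [j] into the right factor leaves one index, the form of r^t that the
    expansions of the three products require. *)
Lemma tensor_pure_sum V W (M : tensor V W) :
  M = \sum_i ebase i \ox (\sum_j M i j *: ebase j) :> tensor V W.
Proof.
rewrite [LHS]tensor_span; apply: eq_bigr => i _.
by rewrite (lin_sum ((tens_bilin _ _).2 _)).
Qed.

End Tensors.

(** * Adjoints under the pairing of U' with U *)

Section Adjoints.
Variables (K : numFieldType) (U : voa K).
Implicit Types (f g : cdual U) (a b u : U).

HB.instance Definition _ f := GRing.isLinear.Build K U K^o _ (pair f : U -> K^o)
  (pair_linear f).

(** With the arguments swapped, the pairing can also be declared linear in the functional. *)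
Definition pairl u f : K^o := pair f u.

Lemma pairl_linear u : linear (pairl u).
Proof.
move=> c f g; rewrite /pairl /pair -fsum_linear; try exact: pair_fsupp.
by apply: eq_fsbigr => n _; rewrite dcoefZD add_lfunE scale_lfunE.
Qed.
HB.instance Definition _ u := GRing.isLinear.Build K (cdual U) K^o _ (pairl u)
  (pairl_linear u).

Lemma pair_dsingle n (h : 'Hom(grade U n, K^o)) u :
  pair (dsingle h : cdual U) u = h (u n).
Proof.
rewrite /pair (fsum_only (j := n)) ?dsingle_in // => k kn.
by rewrite dsingle_out 1?eq_sym // zero_lfunE.
Qed.

Lemma pair_inj f g : (forall u, pair f u = pair g u) -> f = g.
Proof.
move=> fg; apply: dsumP => n; apply/lfunP => v.
by rewrite -!pair_single fg.
Qed.

Lemma pair_eq0 u : (forall f, pair f u = 0) -> u = 0.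
Proof.
move=> u0; apply: dsumP => n; apply: functional_eq0 => h.
by rewrite -pair_dsingle u0.
Qed.

Lemma omegaE : omega U = L (-2) (dsingle (vacuum U) : U).
Proof. by rewrite /L creation1. Qed.

(** Since omega = L(-2)1 and [L(1), L(-2)] = 3L(-1) without central term, it is enough that L(1) and
    L(-1) kill the vacuum. *)
Lemma L1_omega : L 1 (omega U) = 0.
Proof.
pose v : U := dsingle (vacuum U).
have : L 1 (L (-2) v) - L (-2) (L 1 v) = (1 - -2)%:~R *: L (1 + -2) v + 0 *: v.
  exact: (virasoro 1 (-2) v).
rewrite -omegaE scale0r addr0.
have L0 n : 0 <= n + 1 -> L n v = 0.
  by move=> n0; rewrite /L creation.
by rewrite (L0 1 isT) (L0 (1 + -2)) // scaler0 linear0 subr0.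
Qed.

Lemma iter_L1_omega k : iter k.+1 (L 1) (omega U) = 0.
Proof. by rewrite iterSr L1_omega; elim: k => //= k ->; rewrite linear0. Qed.

(** As omega has weight 2, (-z^-2)^{L(0)} multiplies it by z^-4; as L(1)omega = 0, e^{zL(1)} fixes
    it. *)
Lemma adjz_omega i : adjz (omega U) i = if i == -4 then omega U else 0.
Proof.
rewrite /adjz /sapp (fsum_only (j := -4)) => [|j /negPf j4].
  rewrite /omega zL0_single eqxx sqrrN expr1n scale1r -/(omega U).
  have [->|i4] := eqVneq; first by rewrite subrr /= invr1 scale1r.
  case E : (i - -4) => [[|k]|k] //; last by rewrite /expz iter_L1_omega scaler0.
  by case/eqP: i4; lia.
rewrite /omega zL0_single j4.
by apply: slin0; apply: expz_slin; exact: L1_linear.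
Qed.

(** Here z^-4 Y(omega, z^-1) = sum_n L(n) z^(n-2), whose residue is L(1). The index 0 is that of
    L(-1) = omega_0. *)
Lemma dot'_omega u : dot' 0 (omega U) u = L 1 u.
Proof.
rewrite /dot' /Res /mulz /sapp (fsum_only (j := -4)) => [|j /negPf j4].
  by rewrite adjz_omega.
by rewrite adjz_omega j4 /invz /Y mode0l.
Qed.

Lemma pair_cL f u : pair (cL (-1) f) u = pair f (L 1 u).
Proof. by rewrite /cL pair_cmode addNr dot'_omega. Qed.

Lemma pair_expz_cL f u n :
  pair (expz (cL (-1)) f n) u = pair f (expz (L 1) u n).
Proof.
case: n => [k|k] /=; last by rewrite -/(pairl u 0) !linear0.
rewrite -/(pairl u _) linearZ [RHS]linearZ /=; congr (_ *: _ : K^o).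
by rewrite /pairl; elim: k u => //= k IHk u; rewrite pair_cL IHk -iterSr.
Qed.

(** This is the substitution of -z for z: on U(n) the factor (-z^-2)^{L(0)} is a multiple of the
    even power z^(-2n), so only e^{zL(1)} changes. *)
Lemma adjNzE a i : adjNz a i = (-1) ^ i *: adjz a i.
Proof.
elim/dsum_ind: a => [c x y hx hy|n v].
  by rewrite adjNz_slin adjz_slin hx hy scalerDr !scalerA mulrC.
rewrite /adjNz /adjz /sapp.
rewrite !(fsum_only (j := - (2 * n%:Z))) => [|j /negPf jn|j /negPf jn].
- rewrite zL0_single eqxx; set u := _ *: _.
  have iterN k : iter k (fun u : U => - L 1 u) u = (-1) ^+ k *: iter k (L 1) u.
    elim: k => [|k IHk]; first by rewrite expr0 scale1r.
    by rewrite !iterS IHk linearZ exprS mulN1r scaleNr.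
  case E : (i - - (2 * n%:Z)) => [k|k] /=; last by rewrite scaler0.
  rewrite iterN !scalerA mulrC; congr (_ * _ *: _).
  have -> : i = k%:Z + 2 * (- n%:Z) by lia.
  rewrite expfzDr ?oppr_eq0 ?oner_eq0 // -exprz_exp.
  by rewrite -[(-1) ^ 2]/((-1) ^+ 2) sqrrN expr1n exp1rz mulr1.
- by rewrite zL0_single jn; apply: slin0; apply: expz_slin; exact: L1_linear.
- by rewrite zL0_single jn; apply: slin0; apply: expz_slin; exact: NL1_linear.
Qed.

Lemma dot'0r m b : dot' m b 0 = 0.
Proof.
have [_ /(_ b) dl] := @dot'_bilin K U m.
by have := dl (-1) 0 0; rewrite scaler0 addr0 scaleN1r addNr.
Qed.

Lemma dotop_term_fsupp m a b :
  fsupp (fun i : int =>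
    (-1) ^ i *: dot' (- i - 1) b (expz (L 1) a (-1 - m - i))).
Proof.
have [s s0] := expL1_fsupp a; exists [seq -1 - m - l | l <- s] => i si.
rewrite s0 ?dot'0r ?scaler0 //; apply: contra si => si.
by apply/mapP; exists (-1 - m - i) => //; lia.
Qed.

(** By [adjNzE] the series acting on e^{zL(1)}a is the one defining [dot'] for [b], taken at w = -z.
    Its coefficient of w^i is the product [dot'] of index -i-1, and w^i = (-1)^i z^i. *)
Lemma dotopE m a b : dotop m a b = \sum_(i \in [set: int])
  (-1) ^ i *: dot' (- i - 1) b (expz (L 1) a (-1 - m - i)).
Proof.
have [s s0] := expL1_fsupp a; have [t t0] := adjz_fsupp b.
have {}s0 i : i \notin undup s -> expz (L 1) a i = 0.
  by rewrite mem_undup; exact: s0.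
have {}t0 i : i \notin undup t -> adjz b i = 0.
  by rewrite mem_undup; exact: t0.
rewrite /dotop /Res /mulz /sapp.
set n := -1 - m.
rewrite (fsum_seq (undup_uniq t)) => [|j /t0 jt]; last first.
  rewrite adjNzE jt scaler0; apply: fsbig1 => l _.
  by rewrite /negz /invz /Y mode0l scaler0.
(* Reindex by the exponent l = n - i of e^{zL(1)}a, so that both sides become double sums over [s]
   and [t]. *)
rewrite (@fsum_seq _ _ _ [seq n - l | l <- undup s]); last 2 first.
- by rewrite map_inj_uniq ?undup_uniq // => x y /addrI/oppr_inj.
- move=> i si; rewrite s0 ?dot'0r ?scaler0 //; apply: contra si => si.
  by apply/mapP; exists (n - i) => //; lia.
rewrite big_map [RHS](eq_bigr (fun l => \sum_(j <- undup t)
    (-1) ^ (n - l) *: invz (Y (adjz b j) (expz (L 1) a l)) (n - l - j))); last first.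
  move=> l _; rewrite subKr /dot' /Res /mulz /sapp.
  rewrite (_ : -1 - (- (n - l) - 1) = n - l); last by lia.
  rewrite (fsum_seq (undup_uniq t)) ?scaler_sumr // => j /t0 ->.
  by rewrite /invz /Y mode0l.
rewrite exchange_big; apply: eq_bigr => j _.
rewrite (fsum_seq (undup_uniq s)) => [|l /s0 ->]; last first.
  by rewrite /negz /invz /Y linear0 scaler0.
apply: eq_bigr => l _.
(* The signs (-1)^j from [adjNz] and (-1)^(n-l-j) from [negz] combine into (-1)^(n-l). *)
rewrite /negz /invz adjNzE addrAC /Y -/(moder _ _ _) linearZ scalerA /=.
by rewrite -expfzDr ?oppr_eq0 ?oner_eq0 // subrK.
Qed.

(** Moving e^{zL(-1)} and then the modes of [b] across the pairing turns the terms of f(m)b one by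
    one into those of [dotopE]. *)
Lemma pair_cdmode f m b a : pair (cdmode f m b) a = pair f (dotop m a b).
Proof.
rewrite -/(pairl a _) /cdmode /Res /mulz /sapp.
rewrite (fsum_map (pairl a) (cdmode_fsupp _ _ _)) dotopE.
rewrite [RHS](fsum_map (pair f : {linear U -> K^o}) (dotop_term_fsupp m a b)).
apply: eq_fsbigr => i _.
rewrite /= /pairl pair_expz_cL /negz -/(pairl _ _).
by rewrite linearZ [RHS]linearZ /= /pairl pair_cmode.
Qed.

Lemma cmode_linearl m f : linear (fun a => cmode a m f).
Proof.
move=> c a b; apply: pair_inj => u.
have [/(_ u) dl _] := @dot'_bilin K U m.
by rewrite -/(pairl u (_ + _)) linearP /= /pairl !pair_cmode dl linearP.
Qed.

Lemma cmode_linearr a m : linear (cmode a m : cdual U -> cdual U).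
Proof.
move=> c f g; apply: pair_inj => u.
rewrite -/(pairl u (_ + _)) linearP /= /pairl !pair_cmode.
by rewrite -/(pairl _ (_ + _)) linearP.
Qed.

Lemma cdmode_linearr f m : linear (cdmode f m : U -> cdual U).
Proof.
move=> c a b; apply: pair_inj => u.
have [_ /(_ u) dl] := @dotop_bilin K U m.
by rewrite -/(pairl u (_ + _)) linearP /= /pairl !pair_cdmode dl linearP.
Qed.

Lemma cdmode_linearl m a : linear (fun f => cdmode f m a).
Proof.
move=> c f g; apply: pair_inj => u.
rewrite -/(pairl u (_ + _)) linearP /= /pairl !pair_cdmode.
by rewrite -/(pairl _ (_ + _)) linearP.
Qed.

End Adjoints.

(** * Contractions of r and the equivalence *)

Section Equivalence.
Variables (K : numFieldType) (U : voa K) (p : nat -> nat).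
Variables alpha beta : forall t, 'I_(p t) -> grade U t.
Variable r : ctensor2 U.
Hypothesis r_def : forall t, r t t =
  \sum_(i < p t) (alpha i \ox beta i - beta i \ox alpha i).
Local Notation V := (grade U).
Local Notation T := (Tr alpha beta).

Definition Tlevel t (f : 'Hom(V t, K^o)) : V t :=
  \sum_(i < p t) ((f (beta i) : K) *: alpha i - (f (alpha i) : K) *: beta i).

Lemma Tr_coef f t : T f t = Tlevel (f t).
Proof.
rewrite -[LHS]/(dproj t _) /Tr fsum_map; last first.
  have [N fN] := dcoef_fin f; exists (iota 0 N) => k.
  rewrite mem_iota -leqNgt => /fN fk; rewrite big1 ?linear0 // => i _.
  by rewrite fk !zero_lfunE !scale0r subr0.
rewrite (fsum_only (j := t)) => [|k kt] /=; first exact: dsingle_in.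
exact: dsingle_out.
Qed.

Lemma Tr_level_preserving : level_preserving T.
Proof.
move=> n f fn k kn; rewrite Tr_coef fn // /Tlevel big1 // => i _.
by rewrite !zero_lfunE !scale0r subr0.
Qed.

(** Both pairings contract r, and exchanging the two functionals changes the sign of each alpha (x)
    beta - beta (x) alpha. *)
Lemma pair_Tr_skew f g : pair f (T g) = - pair g (T f).
Proof.
elim/dsum_ind: f => [c f f' hf hf'|n f].
  rewrite -/(pairl _ (_ + _)) !linearP /= /pairl hf hf'.
  by rewrite opprD scalerN.
rewrite pair_dsingle Tr_coef Tr_single pair_single /Tlevel !linear_sum -sumrN.
apply: eq_bigr => i _; rewrite !linearB !linearZ /= !scalerN opprB.
by congr (_ - _); exact: mulrC.
Qed.

Lemma bilin_pair (D : U -> U -> U) (h : cdual U) s t : bilin D ->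
  bilin (fun (u : V s) (v : V t) => pair h (D (dsingle u) (dsingle v)) : K^o).
Proof. by case=> Dl Dr; split=> z c u v; rewrite linearP ?Dl ?Dr linearP. Qed.

Section Expansion.
Variables (N : nat -> nat) (x y : forall t, 'I_(N t) -> V t).
Hypothesis rE : forall t, r t t = \sum_(i < N t) x i \ox y i.

(** Both sides are the value at r^t of the linear map induced by [B]. This links the pure tensors
    used to expand the products with the [alpha], [beta] that define T_r. *)
Lemma sum_expansion t (Z : lmodType K) (B : V t -> V t -> Z) : bilin B ->
  \sum_(i < N t) B (x i) (y i) =
  \sum_(i < p t) (B (alpha i) (beta i) - B (beta i) (alpha i)).
Proof.
move=> Bb; rewrite -tlift_sum // -rE r_def linear_sum.
by apply: eq_bigr => i _; rewrite linearB /= !tlift_tens.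
Qed.

Lemma sum_first t (f : 'Hom(V t, K^o)) :
  \sum_(i < N t) (f (y i) : K) *: x i = Tlevel f.
Proof. exact: (sum_expansion (contractr_bilin _ f)). Qed.

Lemma sum_second t (f : 'Hom(V t, K^o)) :
  \sum_(i < N t) (f (x i) : K) *: y i = - Tlevel f.
Proof.
rewrite (sum_expansion (B := fun u v => (f u : K) *: v)); last first.
  split=> z c u v; last by rewrite scalerDr !scalerA mulrC.
  by rewrite linearP scalerDl scalerA.
by rewrite -sumrN; apply: eq_bigr => i _; rewrite opprB.
Qed.

Variables (m : int) (k q s : nat).
Variables (h : 'Hom(V k, K^o)) (f : 'Hom(V q, K^o)) (g : 'Hom(V s, K^o)).

Lemma eval_r12_r13 : eval3 h f g (r12_r13 m r k q s) =
  pair (dsingle h : cdual U) (dot m (T (dsingle f)) (T (dsingle g))).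
Proof.
rewrite (r12_r13E _ rE) !Tr_single -!/(Tlevel _) -!sum_first.
rewrite (bilin_lincomb _ _ _ _ (bilin_pair (dsingle h) q s (@dot_bilin K U m))).
rewrite linear_sum; apply: eq_bigr => i _.
rewrite linear_sum; apply: eq_bigr => j _.
by rewrite /= eval3_tens pair_dsingle -mulrA; exact: mulrC.
Qed.

(** Here [g] meets the right factor of r23 and [h] the left factor of r12, which accounts for the
    single sign. *)
Lemma eval_r23_r12 : eval3 h f g (r23_r12 m r k q s) =
  - pair (dsingle f : cdual U) (dot' m (T (dsingle g)) (T (dsingle h))).
Proof.
have db := bilin_pair (dsingle f) s k (@dot'_bilin K U m).
rewrite (r23_r12E _ rE) !Tr_single -!/(Tlevel _) -[RHS](bilin_oppr _ _ db).
(* The first argument of [dot'] comes from r23, whereas the expansion of the product sums over r12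
   first. *)
rewrite -sum_first -sum_second (bilin_lincomb _ _ _ _ db) exchange_big.
rewrite linear_sum; apply: eq_bigr => j _.
rewrite linear_sum; apply: eq_bigr => i _.
rewrite /= eval3_tens pair_dsingle [LHS]mulrC mulrA.
by rewrite -[RHS]/(_ * _ * _ : K).
Qed.

(** Both [h] and [f] meet left factors, so the two signs cancel. *)
Lemma eval_r13_r23 : eval3 h f g (r13_r23 m r k q s) =
  pair (dsingle g : cdual U) (dotop m (T (dsingle h)) (T (dsingle f))).
Proof.
have db := bilin_pair (dsingle g) k q (@dotop_bilin K U m).
rewrite (r13_r23E _ rE) !Tr_single -!/(Tlevel _).
rewrite -[RHS]opprK -(bilin_oppr _ _ db) -(bilin_oppl _ _ db) -!sum_second.
rewrite (bilin_lincomb _ _ _ _ db).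
rewrite linear_sum; apply: eq_bigr => i _.
rewrite linear_sum; apply: eq_bigr => j _.
by rewrite /= eval3_tens pair_dsingle.
Qed.

End Expansion.

(** The identity is bilinear in the two functionals, and [eval3] only provides it for homogeneous
    ones. *)
Lemma relative_RB_at_dsingle m : relative_RB_at m T <->
  forall s q (g : 'Hom(V s, K^o)) (f : 'Hom(V q, K^o)),
    mode (T (dsingle g)) m (T (dsingle f)) =
    T (cmode (T (dsingle g)) m (dsingle f))
    + T (cdmode (dsingle g) m (T (dsingle f))).
Proof.
split=> [RB *|RB f g]; first exact: RB.
elim/dsum_ind: f => [c f f' hf hf'|s f].
  rewrite linearP mode_linearl hf hf' cmode_linearl cdmode_linearl !linearP.
  by rewrite scalerDr addrACA.
elim/dsum_ind: g => [c g g' hg hg'|q g]; last exact: RB.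
rewrite linearP mode_linearr hg hg' cmode_linearr cdmode_linearr !linearP.
by rewrite scalerDr addrACA.
Qed.

Lemma eval_mVOYBE m k q s (h : 'Hom(V k, K^o)) (f : 'Hom(V q, K^o))
    (g : 'Hom(V s, K^o)) :
  eval3 h f g (r12_r13 m r k q s - r23_r12 m r k q s + r13_r23 m r k q s) =
  pair (dsingle h : cdual U) (mode (T (dsingle g)) m (T (dsingle f))
    - (T (cmode (T (dsingle g)) m (dsingle f))
       + T (cdmode (dsingle g) m (T (dsingle f))))).
Proof.
have rE t := tensor_pure_sum (r t t).
rewrite linearD linearB /= (eval_r12_r13 rE) (eval_r23_r12 rE) (eval_r13_r23 rE).
(* The last two products become pairings with T(h); skewness of T_r then brings [h] to the left,
   each time with a sign. *)
rewrite -pair_cmode -pair_cdmode !(pair_Tr_skew (cmode _ _ _)).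
rewrite (pair_Tr_skew (cdmode _ _ _)) opprK.
by rewrite linearB linearD opprD addrA.
Qed.

Lemma mVOYBE_RB m :
  (forall k q s,
     r12_r13 m r k q s - r23_r12 m r k q s + r13_r23 m r k q s = 0) <->
  relative_RB_at m T.
Proof.
split=> [eq0|/relative_RB_at_dsingle RB k q s].
  apply/relative_RB_at_dsingle => s q g f; apply/eqP; rewrite -subr_eq0.
  apply/eqP/pair_eq0 => h; elim/dsum_ind: h => [c h h' hh hh'|k h].
    by rewrite -/(pairl _ (_ + _)) linearP /= /pairl hh hh' scaler0 addr0.
  by rewrite -eval_mVOYBE eq0 linear0.
by apply: eval3_eq0 => h f g; rewrite eval_mVOYBE RB subrr linear0.
Qed.

End Equivalence.

Theorem theorem2p14 (R : realType) (U : voa R[i])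
    (p : nat -> nat) (alpha beta : forall t : nat, 'I_(p t) -> grade U t)
    (r : ctensor2 U)
    (r_SD : SD r)
    (r_def : forall t : nat,
      r t t = \sum_(i < p t)
                (alpha t i \ox beta t i - beta t i \ox alpha t i)) :
  (forall m : int,
     skew_sol_mVOYBE m r <->
     level_preserving (Tr alpha beta) /\ relative_RB_at m (Tr alpha beta)) /\
  (skew_sol_VOYBE r <->
     level_preserving (Tr alpha beta) /\ relative_RB (Tr alpha beta)).
Proof.
(* T_r preserves levels by construction and r is in SD by assumption, so only the two equations
   remain to be compared. *)
have lp := @Tr_level_preserving _ _ _ alpha beta.
have RB m := mVOYBE_RB r_def m.
split=> [m|]; split.
- by move=> [_ /RB].
- by move=> [_ /RB].
- by move=> sol; split=> // m; have [_ /RB] := sol m.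
- by move=> [_ rb] m; split=> //; exact/RB.
Qed.
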